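(* Let $F$ be a graded field, $D$ a graded central division algebra over $F$ and $H=\Gamma_D/\Gamma_F$. Let $(\bar\delta_i=\delta_i+\Gamma_F)_{1\le i\le r}$ be a basis of $H$, $q_i$ the order of $\bar\delta_i$, and $I=\{(m_1,\dots,m_r)\in\mathbb N^r: 0\le m_i<q_i \text{ for } 1\le i\le r\}$. Fix $x_i\in F^*$ with $gr(x_i)=q_i\delta_i$ and $z_i\in D^*$ with $gr(z_i)=\delta_i$. For $\bar m\in I$ let $\bar m\bar\delta=\sum_i m_i\bar\delta_i$ and $z_{\bar m\bar\delta}=z^{\bar m}=z_1^{m_1}\cdots z_r^{m_r}$ (each $\bar\gamma\in H$ is uniquely $\bar m\bar\delta$ with $\bar m\in I$). Let $f(\bar\gamma,\bar\gamma')=z_{\bar\gamma}z_{\bar\gamma'}z_{\bar\gamma+\bar\gamma'}^{-1}$ for $\bar\gamma,\bar\gamma'\in H$. For $\bar m,\bar n\in I$ let $\beta(\bar m+\bar n)\in I$ be the element congruent to $\bar m+\bar n$ modulo $\prod_i q_i\mathbb Z$, write $m_i+n_i=\beta(\bar m+\bar n)_i+t_iq_i$ with $t_i\in\mathbb N$, and set $h(\bar m\bar\delta,\bar n\bar\delta)=\prod_{i=1}^r x_i^{t_i}$ and $d(\bar m\bar\delta,\bar n\bar\delta)=f(\bar m\bar\delta,\bar n\bar\delta)\,h(\bar m\bar\delta,\bar n\bar\delta)^{-1}\in D_0^*$. Let $\omega:H\to Aut(D_0)$ be defined by $\omega_{\bar\gamma}(a)=z_{\bar\gamma}az_{\bar\gamma}^{-1}$.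 Then $(\omega,d)$ is a factor set of $H$ in $D_0$, and $h\in Z^2(H,F^* )_{sym}$.
   Context: Gradings are by torsion-free (totally ordered) abelian groups. For a graded ring $R=\bigoplus_\gamma R_\gamma$, $\Gamma_R$ is its support $\{\gamma:R_\gamma\ne0\}$, $gr(x)=\gamma$ for $0\ne x\in R_\gamma$, and $R^*$ is the group of units. A graded field (resp. graded division algebra) is a commutative graded ring (resp. graded ring) in which every nonzero homogeneous element is invertible; its units are exactly the nonzero homogeneous elements. A graded central division algebra over a graded field $F$ is a graded division algebra $D$ with center $F$ (as graded ring) and $[D:F]<\infty$; $\Gamma_D/\Gamma_F$ is then a finite abelian group. A basis of a finite abelian group is a family of elements such that the group is the direct sum of the cyclic subgroups they generate. $H=\Gamma_D/\Gamma_F$ acts on $Z(D_0)$ via $\theta_D(gr(x)+\Gamma_F)(a)=xax^{-1}$ for $x\in D^*$, and trivially on $F^*$. $Z^2(H,F^* )_{sym}$ is the group of symmetric 2-cocycles for this trivial action. Factor sets: let $A$ be a central simple algebra over a field $L$ and $H$ a finite group acting on $L$ by automorphisms. A factor set of $H$ in $A$ is a pair of maps $\omega:H\to Aut(A)$ (ring automorphisms), $f:H\times H\to A^*$ with $\omega_\sigma|_L=\sigma$, $\omega_\sigma\omega_\tau=Inn(f(\sigma,\tau))\omega_{\sigma\tau}$ where $Inn(c)(a)=cac^{-1}$, and $f(\sigma,\tau)f(\sigma\tau,\mu)=\omega_\sigma(f(\tau,\mu))f(\sigma,\tau\mu)$ for all $\sigma,\tau,\mu\in H$. Here $A=D_0$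 and $L=Z(D_0)$. *)

(* Defs.v *)
From HB Require Import structures.
From mathcomp Require Import all_boot all_order all_algebra all_fingroup.
From mathcomp Require Import generic_quotient ring_quotient.
From mathcomp Require Import cyclic boolp classical_sets.

Set Implicit Arguments.
Unset Strict Implicit.
Unset Printing Implicit Defensive.

Import GRing.Theory.
Local Open Scope ring_scope.
Local Open Scope quotient_scope.

Definition torsion_free (Gam : zmodType) : Prop :=
  forall (g : Gam) (n : nat), (0 < n)%N -> g *+ n = 0 -> g = 0.

Definition finite_free (R : nzRingType) (M : lmodType R) : Prop :=
  exists (n : nat) (e : 'I_n -> M),
    forall x : M, exists! c : {ffun 'I_n -> R}, x = \sum_(i < n) c i *: e i.

Record grading (Gam : zmodType) (R : nzRingType) := Grading {
  hcomp :> Gam -> {pred R};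
  hcomp_zmod : forall g, zmod_closed (hcomp g);
  hcomp_sum : forall x : R, exists (s : seq Gam) (c : Gam -> R),
    [/\ uniq s, forall g, c g \in hcomp g & x = \sum_(g <- s) c g];
  hcomp_indep : forall (s : seq Gam) (c : Gam -> R),
    uniq s -> (forall g, c g \in hcomp g) -> \sum_(g <- s) c g = 0 ->
    forall g, g \in s -> c g = 0;
  hcomp1 : 1 \in hcomp 0;
  hcompM : forall g g' x y,
    x \in hcomp g -> y \in hcomp g' -> x * y \in hcomp (g + g') }.

Definition support (Gam : zmodType) (R : nzRingType) (G : grading Gam R) :
  {pred Gam} := fun g => `[< exists2 x, x \in G g & x != 0 >].

Definition homog_invertible (Gam : zmodType) (R : unitRingType)
    (G : grading Gam R) : Prop :=
  forall g x, x \in G g -> x != 0 -> x \is a GRing.unit.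

Record gradedField (Gam : zmodType) := GradedField {
  gf_sort :> comUnitRingType;
  gf_grading : grading Gam gf_sort;
  gf_inv : homog_invertible gf_grading }.

(* c |-> c%:A identifies F with the center of D, as graded rings. *)
Record gradedCentralDivAlg (Gam : zmodType) (F : gradedField Gam) :=
  GradedCentralDivAlg {
    gd_sort :> unitAlgType F;
    gd_grading : grading Gam gd_sort;
    gd_inv : homog_invertible gd_grading;
    gd_inj : injective (fun c : F => c%:A : gd_sort);
    gd_center : forall a : gd_sort,
      (forall b, a * b = b * a) <-> (exists c : F, a = c%:A);
    gd_gr : forall g (c : F),
      (c%:A \in gd_grading g) = (c \in gf_grading F g);
    gd_fin : finite_free gd_sort }.

Section GradingTheory.
Variables (Gam : zmodType) (R : unitRingType) (G : grading Gam R).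

Lemma hcomp0 g : 0 \in G g. Proof. by case: (hcomp_zmod G g). Qed.
Lemma hcompB g x y : x \in G g -> y \in G g -> x - y \in G g.
Proof. by case: (hcomp_zmod G g) => _; apply. Qed.
Lemma hcompN g x : x \in G g -> - x \in G g.
Proof. by move=> Gx; rewrite -sub0r hcompB ?hcomp0. Qed.
Lemma hcompD g x y : x \in G g -> y \in G g -> x + y \in G g.
Proof. by move=> Gx Gy; rewrite -[y]opprK hcompB ?hcompN. Qed.
Lemma hcomp_sumr g (I : Type) (s : seq I) (P : pred I) (E : I -> R) :
  (forall i, P i -> E i \in G g) -> \sum_(i <- s | P i) E i \in G g.
Proof.
move=> EG; elim/big_ind: _ => //; [exact: hcomp0 | by move=> *; apply: hcompD].
Qed.

Lemma hcomp_unique g g' x : x \in G g -> x \in G g' -> x != 0 -> g = g'.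
Proof.
move=> Gx Gx' x0; apply/eqP/negPn/negP => gg'.
have g'g : g' != g by rewrite eq_sym.
pose c h := if h == g then x else if h == g' then - x else 0.
have := @hcomp_indep _ _ G [:: g; g'] c.
rewrite /= inE gg' => /(_ isT) H.
have cG h : c h \in G h.
  rewrite /c; case: eqP => [->//|_]; case: eqP => [->|_]; last exact: hcomp0.
  exact: hcompN.
have := H cG; rewrite !big_cons big_nil /c !eqxx (negbTE g'g) addr0 subrr.
by move=> /(_ erefl g); rewrite !inE eqxx => /(_ isT) /eqP; rewrite (negbTE x0).
Qed.

Lemma hcomp_proj g x (I : eqType) (s : seq I) (d : I -> Gam) (y : I -> R) :
  x \in G g -> (forall i, y i \in G (d i)) -> x = \sum_(i <- s) y i ->
  x = \sum_(i <- s | d i == g) y i.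
Proof.
move=> Gx Gy xE.
pose c k := (if k == g then x else 0) - \sum_(i <- s | d i == k) y i.
pose t := undup (g :: map d s).
have ut : uniq t by rewrite undup_uniq.
have cG k : c k \in G k.
  apply: hcompB; first by case: eqP => [->//|_]; exact: hcomp0.
  by apply: hcomp_sumr => i /eqP <-.
have gt : g \in t by rewrite mem_undup inE eqxx.
have sum0 : \sum_(k <- t) c k = 0.
  rewrite big_split /= sumrN (bigD1_seq g) //= eqxx.
  rewrite [X in _ + X - _]big1 ?addr0 => [|k /negbTE -> //].
  rewrite (exchange_big_dep xpredT) //=; apply/eqP; rewrite subr_eq0 xE.
  apply/eqP; apply: eq_big_seq => k ks.
  have kt : d k \in t by rewrite mem_undup inE (map_f d) ?orbT.
  rewrite big_mkcond (bigD1_seq (d k)) //= eqxx big1 ?addr0 // => l.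
  by rewrite eq_sym => /negbTE ->.
have /eqP := hcomp_indep ut cG sum0 gt.
by rewrite /c eqxx subr_eq0 => /eqP.
Qed.

Lemma hcompV g x : x \is a GRing.unit -> x \in G g -> x^-1 \in G (- g).
Proof.
move=> Ux Gx.
have [s [c [us cG xE]]] := hcomp_sum G x^-1.
have xcG h : x * c h \in G (g + h) by apply: hcompM.
have sum1 : 1 = \sum_(h <- s) x * c h by rewrite -mulr_sumr -xE divrr.
have e : 1 = x * \sum_(h <- s | g + h == 0) c h.
  by rewrite mulr_sumr -(hcomp_proj (hcomp1 G) xcG sum1).
rewrite -[x^-1]mulr1 e mulKr //.
by apply: hcomp_sumr => h /eqP gh; rewrite -(addKr g h) gh addr0.
Qed.

Hypothesis Ginv : homog_invertible G.

Lemma support_zmod : zmod_closed (support G).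
Proof.
split; first by apply/asboolP; exists 1; rewrite ?oner_eq0 // hcomp1.
move=> g g' /asboolP [x Gx x0] /asboolP [y Gy y0].
have [Ux Uy] := (Ginv Gx x0, Ginv Gy y0).
apply/asboolP; exists (x / y); first exact: hcompM (hcompV Uy Gy).
by apply/eqP => xy0; move: (@unitr0 R); rewrite -xy0 unitrMl ?unitrV // Ux.
Qed.

End GradingTheory.

Lemma finite_free_span (L : fieldType) (M : lmodType L) n (e : 'I_n -> M) :
  (forall x, exists c : 'I_n -> L, x = \sum_(i < n) c i *: e i) ->
  finite_free M.
Proof.
elim: n e => [|n IHn] e eS.
  exists 0%N, e => x; exists [ffun=> 0]; split=> [|c _].
    by have [c ->] := eS x; rewrite !big_ord0.
  by apply/ffunP => -[].
case: (pselect (exists (k : 'I_n.+1 -> L) (j : 'I_n.+1),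
    k j != 0 /\ \sum_(i < n.+1) k i *: e i = 0)) => [[k [j [kj0 k0]]]|indep].
  apply: (IHn (fun i => e (lift j i))) => x; have [c ->] := eS x.
  exists (fun i => c (lift j i) - c j * (k j)^-1 * k (lift j i)).
  have ej : e j = - \sum_(i < n) ((k j)^-1 * k (lift j i)) *: e (lift j i).
    move/eqP: k0; rewrite (bigD1_ord j) //= addr_eq0 => /eqP.
    move=> /(congr1 ( *:%R (k j)^-1)).
    rewrite scalerA mulVf // scale1r => ->; rewrite scalerN scaler_sumr.
    by congr (- _); apply: eq_bigr => i _; rewrite scalerA.
  rewrite (bigD1_ord j) //= ej scalerN scaler_sumr addrC -sumrB.
  by apply: eq_bigr => i _; rewrite scalerA scalerBl mulrA.
exists n.+1, e => x; have [c xE] := eS x.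
exists (finfun c); split=> [|c' xE'].
  by rewrite xE; apply: eq_bigr => i _; rewrite ffunE.
apply/ffunP => i; rewrite ffunE; apply/eqP; rewrite -subr_eq0.
apply: contra_notT indep => cc'; exists (fun i => c i - c' i), i; split=> //.
under eq_bigr do rewrite scalerBl.
by rewrite sumrB -xE -xE' subrr.
Qed.

Definition ring_aut (A : nzRingType) (w : A -> A) : Prop :=
  [/\ bijective w, zmod_morphism w & monoid_morphism w].

Definition acts_by_automorphisms (G : finGroupType) (L : fieldType)
    (act : G -> L -> L) : Prop :=
  [/\ forall s, ring_aut (act s),
      forall a, act 1%g a = a
    & forall s t a, act (s * t)%g a = act s (act t a)].

Definition central_simple (L : fieldType) (A : unitAlgType L) : Prop :=
  [/\ finite_free A,
      forall a : A, (forall b, a * b = b * a) <-> (exists c : L, a = c%:A)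
    & forall J : {pred A}, zmod_closed J ->
        (forall a b, b \in J -> a * b \in J /\ b * a \in J) ->
        (forall b, b \in J -> b = 0) \/ (forall b, b \in J)].

(* Meant for A central simple over L and act satisfying acts_by_automorphisms;
   D0_central_simple and theta_acts below check this for D_0 and theta. *)
Record factor_set (G : finGroupType) (L : fieldType) (act : G -> L -> L)
    (A : unitAlgType L) (w : G -> A -> A) (f : G -> G -> A) : Prop :=
  FactorSet {
  fs_aut : forall s, ring_aut (w s);
  fs_unit : forall s t, f s t \is a GRing.unit;
  fs_act : forall s (a : L), w s a%:A = (act s a)%:A;
  fs_inn : forall s t a, w s (w t a) = f s t * w (s * t)%g a / f s t;
  fs_cocycle : forall s t u,
    f s t * f (s * t)%g u = w s (f t u) * f s (t * u)%g }.

(* Z^2(G, R^* )_sym for the trivial action of G on R^* *)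
Record sym_cocycle (G : finGroupType) (R : comUnitRingType) (h : G -> G -> R) :
    Prop := SymCocycle {
  sc_unit : forall s t, h s t \is a GRing.unit;
  sc_cocycle : forall s t u,
    h s t * h (s * t)%g u = h t u * h s (t * u)%g;
  sc_sym : forall s t, h s t = h t s }.

Section Coordinates.
Variables (H : finZmodType) (r : nat) (e : 'I_r -> H).

Definition is_basis : Prop := (\big[dprod/1]_(i < r) <[e i]> = [set: H])%g.

Definition qord (i : 'I_r) : nat := #[e i]%g.

Definition box (m : 'I_r -> nat) : Prop := forall i, (m i < qord i)%N.

Definition comb (m : 'I_r -> nat) : H := \sum_(i < r) e i *+ m i.

(* When is_basis holds, the unique m in the box with comb m = g: see coordP and
   comb_inj. *)
Definition coord (g : H) : {ffun 'I_r -> nat} :=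
  xget [ffun=> 0%N] [set m : {ffun 'I_r -> nat} | box m /\ comb m = g]%classic.

Hypothesis eB : is_basis.

Lemma combE m : comb m = (\prod_(i < r) e i ^+ m i)%g.
Proof. by []. Qed.

Lemma coordP g : box (coord g) /\ comb (coord g) = g.
Proof.
apply: (@xgetPex _ [ffun=> 0%N]
  [set m : {ffun 'I_r -> nat} | box m /\ comb m = g]%classic).
have [c [cP gE _]] := mem_bigdprod eB (finset.in_setT g).
have /choice [m mP] (i : 'I_r) : exists k,
    (k < #[e i]%g)%N /\ c i = (e i ^+ k)%g.
  by have /cyclePmin [k ? ?] := cP i isT; exists k.
exists (finfun m); split=> [i|]; first by rewrite ffunE; case: (mP i).
rewrite combE gE; apply: eq_bigr => i _; rewrite ffunE.
by case: (mP i).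
Qed.

Lemma comb_inj m n : box m -> box n -> comb m = comb n -> m =1 n.
Proof.
move=> mI nI mn i.
have [c [_ _ cU]] := mem_bigdprod eB (finset.in_setT (comb m)).
have eX (k : 'I_r -> nat) (j : 'I_r) : true -> (e j ^+ k j)%g \in <[e j]>%g.
  by rewrite mem_cycle.
have /eqP := cU _ (eX n) mn i isT.
rewrite -(cU _ (eX m) erefl i isT) eq_expg_mod_order.
by rewrite !modn_small // => /eqP.
Qed.

Lemma coord_comb m : box m -> coord (comb m) =1 m.
Proof.
move=> mI; have [cI cE] := coordP (comb m).
exact: comb_inj cE.
Qed.

End Coordinates.

Section DegreeGroups.
Variables (Gam : zmodType) (F : gradedField Gam) (D : gradedCentralDivAlg F).

Definition suppD : Gam -> bool := support (gd_grading D).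
HB.instance Definition _ :=
  GRing.isZmodClosed.Build Gam suppD (support_zmod (@gd_inv _ _ D)).

Record GammaD := MkGammaD { gdeg :> Gam; gdegP : gdeg \in suppD }.
HB.instance Definition _ := [isSub for gdeg].
HB.instance Definition _ := [Choice of GammaD by <:].
HB.instance Definition _ := [SubChoice_isSubZmodule of GammaD by <:].

(* Gamma_F, as a subgroup of Gamma_D *)
Definition suppF : GammaD -> bool := fun g => gdeg g \in support (gf_grading F).
Lemma suppF_zmod : zmod_closed suppF.
Proof.
have [S0 SB] := support_zmod (@gf_inv _ F).
by split=> [|g g' Sg Sg']; [exact: S0 | exact: SB].
Qed.
HB.instance Definition _ := GRing.isZmodClosed.Build GammaD suppF suppF_zmod.

Definition Hgrp := Quotient.quot (GRing.ZmodClosed.clone GammaD suppF _).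
HB.instance Definition _ := GRing.Zmodule.on Hgrp.
HB.instance Definition _ := EqQuotient.on Hgrp.

Definition cls (g : GammaD) : Hgrp := \pi g.

Lemma cls_eq g g' : (cls g == cls g') = (g - g' \in suppF).
Proof.
exact/esym/(Quotient.idealrBE (GRing.ZmodClosed.clone GammaD suppF _)).
Qed.

Lemma clsD : {morph cls : g g' / g + g'}.
Proof. by move=> g g'; rewrite /cls raddfD. Qed.

Lemma cls_repr (s : Hgrp) : cls (repr s) = s.
Proof. by rewrite /cls reprK. Qed.

Lemma homog_generators : exists (m : nat) (e : 'I_m -> D) (d : 'I_m -> Gam),
  (forall i, e i \in gd_grading D (d i)) /\
  forall g x, x \in gd_grading D g -> exists a : 'I_m -> F,
    (forall i, a i \in gf_grading F (g - d i)) /\ x = \sum_(i < m) a i *: e i.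
Proof.
have [n [b bP]] := gd_fin D.
have /choice [S SP] (j : 'I_n) : exists sc : seq Gam * (Gam -> D),
    (forall g, sc.2 g \in gd_grading D g) /\ b j = \sum_(g <- sc.1) sc.2 g.
  by have [s [c [_ ? ?]]] := hcomp_sum (gd_grading D) (b j); exists (s, c).
pose L := [seq (j, g) | j <- index_enum 'I_n, g <- (S j).1].
pose p (i : 'I_(size L)) := tnth (in_tuple L) i.
exists (size L), (fun i => (S (p i).1).2 (p i).2), (fun i => (p i).2).
split=> [i|g x Gx]; first by case: (SP (p i).1).
have [c [xE _]] := bP x.
pose e i := (S (p i).1).2 (p i).2.
have {}xE : x = \sum_(i < size L) c (p i).1 *: e i.
  rewrite xE -(big_tnth _ _ L xpredT (fun q => c q.1 *: (S q.1).2 q.2)).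
  rewrite big_allpairs_dep /=; apply: eq_bigr => j _.
  by case: (SP j) => _ {1}->; rewrite scaler_sumr.
have /choice [T TP] (i : 'I_(size L)) : exists sc : seq Gam * (Gam -> F),
    (forall h, sc.2 h \in gf_grading F h) /\
    c (p i).1 = \sum_(h <- sc.1) sc.2 h.
  have [s [c' [_ ? ?]]] := hcomp_sum (gf_grading F) (c (p i).1).
  by exists (s, c').
exists (fun i => \sum_(h <- (T i).1 | h + (p i).2 == g) (T i).2 h); split=> [i|].
  by apply: hcomp_sumr => h /eqP <-; rewrite addrK; case: (TP i).
pose K := [seq (i, h) | i <- index_enum 'I_(size L), h <- (T i).1].
pose y (q : 'I_(size L) * Gam) := (T q.1).2 q.2 *: e q.1.
have yG q : y q \in gd_grading D (q.2 + (p q.1).2).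
  rewrite /y -mulr_algl; apply: hcompM; last exact: (proj1 (SP (p q.1).1)).
  by rewrite gd_gr; exact: (proj1 (TP q.1)).
have yE : x = \sum_(q <- K) y q.
  rewrite xE big_allpairs_dep; apply: eq_bigr => i _.
  by case: (TP i) => _ ->; rewrite scaler_suml.
rewrite {1}(hcomp_proj Gx yG yE) big_mkcond big_allpairs_dep /=.
by apply: eq_bigr => i _; rewrite -big_mkcond /= scaler_suml.
Qed.

Lemma Hgrp_enum : exists s : seq Hgrp, uniq s /\ forall x, x \in s.
Proof.
have [m [e [d [eG eP]]]] := homog_generators.
exists (undup [seq cls g | g <- pmap insub [seq d i | i <- enum 'I_m]]).
split=> [|s]; first exact: undup_uniq.
rewrite mem_undup -(cls_repr s); set g := repr s.
have /asboolP [x Gx x0] := gdegP g.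
have [a [aG xE]] := eP _ _ Gx.
have [i ai0] : exists i, a i *: e i != 0.
  apply/existsP; apply: contraNT x0 => /existsPn h.
  by rewrite xE big1 // => i _; apply/eqP/negPn/h.
have a0 : a i != 0 by apply: contraNneq ai0 => ->; rewrite scale0r.
have e0 : e i != 0 by apply: contraNneq ai0 => ->; rewrite scaler0.
have dS : d i \in suppD by apply/asboolP; exists (e i).
apply/mapP; exists (MkGammaD dS).
  by rewrite mem_pmap_sub; apply/mapP; exists i; rewrite ?mem_enum.
by apply/eqP; rewrite cls_eq; apply/asboolP; exists (a i); rewrite ?aG.
Qed.

Let Henum : seq Hgrp := sval (cid Hgrp_enum).
Let HenumP := svalP (cid Hgrp_enum).
Lemma Hgrp_indexK :
  pcancel (fun x : Hgrp => index x Henum) (fun i => nth None (map some Henum) i).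
Proof.
move=> x /=; have xs : x \in Henum by case: HenumP.
by rewrite (nth_map x) ?index_mem ?nth_index.
Qed.
HB.instance Definition _ := PCanIsCountable Hgrp_indexK.
Lemma Hgrp_finite_axiom : Finite.axiom Henum.
Proof. by case: HenumP => us ms x; rewrite count_uniq_mem ?ms. Qed.
HB.instance Definition _ := isFinite.Build Hgrp Hgrp_finite_axiom.

Lemma conj_homog0 g x a :
  x \in gd_grading D g -> x \is a GRing.unit ->
  a \in gd_grading D 0 -> x * a / x \in gd_grading D 0.
Proof.
move=> Gx Ux Ga; rewrite -[X in gd_grading D X](addrN g) -{1}[g]addr0.
by apply: hcompM; [apply: hcompM | apply: hcompV].
Qed.

Definition D0pred : D -> bool := fun a => a \in gd_grading D 0.
Lemma D0_divring : divring_closed D0pred.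
Proof.
split=> [|a b|a b Ga Gb]; first exact: hcomp1; first exact: hcompB.
have [->|b0] := eqVneq b 0; first by rewrite invr0 mulr0; apply: hcomp0.
rewrite /D0pred unfold_in /= -[X in gd_grading D X](addrN 0).
by apply: hcompM => //; apply: hcompV => //; apply: gd_inv Gb b0.
Qed.
HB.instance Definition _ := GRing.isDivringClosed.Build D D0pred D0_divring.

Record D0 := MkD0 { d0val :> D; d0P : d0val \in D0pred }.
HB.instance Definition _ := [isSub for d0val].
HB.instance Definition _ := [Choice of D0 by <:].
HB.instance Definition _ := [SubChoice_isSubUnitRing of D0 by <:].

Lemma D0_unit (a : D0) : a != 0 -> a \is a GRing.unit.
Proof.
move=> a0; have Ua : val a \is a GRing.unit by apply: gd_inv (d0P a) _.
have aV : (val a)^-1 \in D0pred by rewrite rpredV (d0P a).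
by apply/unitrP; exists (MkD0 aV); split; apply: val_inj;
   rewrite /= ?mulVr ?divrr.
Qed.

Definition Z0pred : D0 -> bool := fun a => `[< forall b, a * b = b * a >].
Lemma Z0_divring : divring_closed Z0pred.
Proof.
split=> [|a b /asboolP aZ /asboolP bZ|a b /asboolP aZ /asboolP bZ];
  apply/asboolP => c; first by rewrite mulr1 mul1r.
  by rewrite mulrBl mulrBr aZ bZ.
by rewrite -mulrA -(commrV (esym (bZ c))) mulrA aZ mulrA.
Qed.
HB.instance Definition _ := GRing.isDivringClosed.Build D0 Z0pred Z0_divring.

Record Z0 := MkZ0 { z0val :> D0; z0P : z0val \in Z0pred }.
HB.instance Definition _ := [isSub for z0val].
HB.instance Definition _ := [Choice of Z0 by <:].
HB.instance Definition _ := [SubChoice_isSubUnitRing of Z0 by <:].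

Lemma Z0C (a : Z0) (b : D0) : z0val a * b = b * z0val a.
Proof. by have /asboolP := z0P a; apply. Qed.

Lemma Z0_mulC : @commutative Z0 Z0 *%R.
Proof. by move=> a b; apply: val_inj; apply: Z0C. Qed.
HB.instance Definition _ := GRing.PzRing_hasCommutativeMul.Build Z0 Z0_mulC.

Lemma Z0_field : GRing.field_axiom Z0.
Proof.
move=> a a0; have Ua : val a \is a GRing.unit by apply: D0_unit.
have aV : (val a)^-1 \in Z0pred by rewrite rpredV (z0P a).
by apply/unitrP; exists (MkZ0 aV); split; apply: val_inj;
   rewrite /= ?mulVr ?divrr.
Qed.
HB.instance Definition _ := GRing.ComUnitRing_isField.Build Z0 Z0_field.

Definition Z0scale (c : Z0) (a : D0) : D0 := z0val c * a.
Fact Z0scaleA a b v : Z0scale a (Z0scale b v) = Z0scale (a * b) v.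
Proof. exact: mulrA. Qed.
Fact Z0scale1 : left_id 1 Z0scale. Proof. by move=> a; apply: mul1r. Qed.
Fact Z0scaleDr : right_distributive Z0scale +%R.
Proof. by move=> a u v; apply: mulrDr. Qed.
Fact Z0scaleDl v : {morph Z0scale^~ v : a b / a + b}.
Proof. by move=> a b; apply: mulrDl. Qed.
HB.instance Definition _ := GRing.Zmodule_isLmodule.Build Z0 D0
  Z0scaleA Z0scale1 Z0scaleDr Z0scaleDl.
Fact Z0scaleAl (a : Z0) (u v : D0) : a *: (u * v) = (a *: u) * v.
Proof. exact: mulrA. Qed.
HB.instance Definition _ := GRing.Lmodule_isLalgebra.Build Z0 D0 Z0scaleAl.
Fact Z0scaleAr (a : Z0) (u v : D0) : a *: (u * v) = u * (a *: v).
Proof. by rewrite /GRing.scale /= /Z0scale mulrA Z0C mulrA. Qed.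
HB.instance Definition _ := GRing.Lalgebra_isAlgebra.Build Z0 D0 Z0scaleAr.

(* theta conjugates by a homogeneous unit chosen in each class; thetaE shows
   that the choice is immaterial. *)
Definition hrep (s : Hgrp) : D := s2val (cid2 (asboolW (gdegP (repr s)))).
Lemma hrepP s : hrep s \in gd_grading D (repr s).
Proof. exact: (s2valP (cid2 (asboolW (gdegP (repr s))))). Qed.
Lemma hrep_unit s : hrep s \is a GRing.unit.
Proof.
apply: gd_inv (hrepP s) _.
exact: (s2valP' (cid2 (asboolW (gdegP (repr s))))).
Qed.

Definition thetaD0 (s : Hgrp) (a : D0) : D0 :=
  MkD0 (conj_homog0 (hrepP s) (hrep_unit s) (d0P a)).
Lemma thetaD0_center s (a : Z0) : thetaD0 s a \in Z0pred.
Proof.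
apply/asboolP => b; apply: val_inj => /=.
set x := hrep s; have Ux : x \is a GRing.unit := hrep_unit s.
have b'P : x^-1 * val b * x \in D0pred.
  rewrite -{2}[x]invrK; apply: conj_homog0 (d0P b); last by rewrite unitrV.
  exact: hcompV Ux (hrepP s).
have := congr1 val (Z0C a (MkD0 b'P)) => /= e.
apply: (mulIr Ux); apply: (mulrI (x := x^-1)); first by rewrite unitrV.
by move: e; rewrite !mulrA mulVr // mul1r mulrVK // => ->.
Qed.
Definition theta (s : Hgrp) (a : Z0) : Z0 := MkZ0 (thetaD0_center s a).

Lemma thetaE (g : GammaD) (x : D) (a : Z0) :
    x \in gd_grading D g -> x \is a GRing.unit ->
  val (val (theta (cls g) a)) = x * val (val a) / x.
Proof.
move=> Gx Ux /=; set y := hrep (cls g).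
have Uy : y \is a GRing.unit := hrep_unit (cls g).
have /asboolP [c Fc c0] : g - repr (cls g) \in suppF.
  by rewrite -cls_eq cls_repr.
have Uc : c%:A \is a @GRing.unit D.
  exact: (rmorph_unit (in_alg D) (gf_inv Fc c0)).
have uP : x^-1 * (c%:A * y) \in D0pred.
  rewrite /D0pred unfold_in /= -[X in gd_grading D X](addNr (gdeg g)).
  apply: hcompM; first exact: hcompV.
  rewrite -[gdeg g](subrK (gdeg (repr (cls g)))).
  by apply: hcompM; [rewrite gd_gr | apply: hrepP].
have := congr1 val (Z0C a (MkD0 uP)) => /= e.
have cC b : c%:A * b = b * c%:A :> D.
  by rewrite mulr_algl mulr_algr.
apply: (mulIr Uy); rewrite mulrVK //; apply: (mulrI Uc).
rewrite mulrA -{1}[c%:A * y](mulVKr Ux) -[LHS]mulrA -e.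
by rewrite [c%:A * y]cC [RHS]cC !mulrA.
Qed.

End DegreeGroups.

Section D0Theory.
Variables (Gam : zmodType) (F : gradedField Gam) (D : gradedCentralDivAlg F).

Lemma D0_central_simple : central_simple (D0 D).
Proof.
split.
- have [m [e [d [eG eP]]]] := homog_generators D.
  have /choice [u uP] (i : 'I_m) : exists v : F, [/\ v \in gf_grading F (- d i)
      & v = 0 -> forall a, a \in gf_grading F (- d i) -> a = 0].
    case: (pselect (exists2 v, v \in gf_grading F (- d i) & v != 0)).
      by case=> v Fv v0; exists v; split=> // v0'; rewrite v0' eqxx in v0.
    move=> nov; exists 0; split=> [|_ a Fa]; first exact: hcomp0.
    by apply/eqP/negPn/negP => a0; apply: nov; exists a.
  have eP0 i : u i *: e i \in D0pred (D := D).
    rewrite /D0pred unfold_in /= -(addNr (d i)) -mulr_algl.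
    by apply: hcompM; rewrite ?gd_gr //; case: (uP i).
  apply: (finite_free_span (e := fun i => MkD0 (eP0 i))) => x.
  have [a [aG xE]] := eP _ _ (d0P x).
  have cP i : (a i / u i)%:A \in D0pred (D := D).
    rewrite /D0pred unfold_in /= gd_gr.
    have [->|u0] := eqVneq (u i) 0; first by rewrite invr0 mulr0 hcomp0.
    have := aG i; rewrite sub0r => Fa; rewrite -(addrN (- d i)).
    have Fu : u i \in gf_grading F (- d i) by case: (uP i).
    by apply: hcompM Fa (hcompV (gf_inv Fu u0) Fu).
  have cZ i : MkD0 (cP i) \in Z0pred (D := D).
    by apply/asboolP => b; apply: val_inj; rewrite /= mulr_algl mulr_algr.
  exists (fun i => MkZ0 (cZ i)); apply: val_inj.
  rewrite [LHS]xE raddf_sum; apply: eq_bigr => i _ /=.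
  rewrite mulr_algl scalerA.
  have [u0|u0] := eqVneq (u i) 0.
    case: (uP i) => _ /(_ u0) /(_ (a i)) ->; rewrite ?mul0r //.
    by have := aG i; rewrite sub0r.
  have Fu : u i \in gf_grading F (- d i) by case: (uP i).
  by rewrite mulrVK //; exact: gf_inv Fu u0.
- move=> a; split=> [aZ|[c ->] b]; last by rewrite mulr_algl mulr_algr.
  have aP : a \in Z0pred (D := D) by apply/asboolP.
  by exists (MkZ0 aP); rewrite -[LHS]mulr1.
- move=> J [J0 _] JM.
  case: (pselect (exists2 b, b \in J & b != 0)) => [[b Jb b0]|noJ].
    right=> c; have [+ _] := JM (c / b) _ Jb.
    by rewrite mulrVK //; apply: D0_unit.
  by left=> b Jb; apply/eqP/negPn/negP => b0; apply: noJ; exists b.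
Qed.

Lemma theta_acts : acts_by_automorphisms
  (G := (Hgrp D : finZmodType)) (theta (D := D)).
Proof.
have rep (s : Hgrp D) : exists g : GammaD D, exists x : D,
    [/\ s = cls g, x \in gd_grading D g & x \is a GRing.unit].
  by exists (repr s), (hrep s); rewrite cls_repr hrepP hrep_unit.
have theta0 (a : Z0 D) : theta 0 a = a.
  apply: val_inj; apply: val_inj.
  have -> : 0 = cls (0 : GammaD D) by rewrite /cls raddf0.
  by rewrite (thetaE (x := 1)) ?unitr1 ?hcomp1 // divr1 mul1r.
have thetaD (s t : Hgrp D) a : theta (s + t) a = theta s (theta t a).
  have [g [x [-> Gx Ux]]] := rep s; have [g' [y [-> Gy Uy]]] := rep t.
  apply: val_inj; apply: val_inj.
  have Gxy : x * y \in gd_grading D (g + g') := hcompM Gx Gy.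
  have Uxy : x * y \is a GRing.unit by rewrite unitrMl.
  rewrite -clsD (thetaE _ Gxy Uxy).
  by rewrite (thetaE _ Gx Ux) (thetaE _ Gy Uy) invrM // !mulrA.
split=> // s; have [g [x [-> Gx Ux]]] := rep s; split.
- exists (theta (- cls g)) => a; rewrite -thetaD ?addNr ?addrN //.
- move=> a b; apply: val_inj; apply: val_inj => /=.
  by rewrite mulrBr mulrBl.
- split=> [|a b]; apply: val_inj; apply: val_inj => /=.
    by rewrite mulr1 divrr ?hrep_unit.
  by rewrite !mulrA mulrVK ?hrep_unit.
Qed.

End D0Theory.

Section FactorSetData.
Variables (Gam : zmodType) (F : gradedField Gam) (D : gradedCentralDivAlg F).
Variables (r : nat) (dl : 'I_r -> GammaD D) (x : 'I_r -> F) (z : 'I_r -> D).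

Definition dbar (i : 'I_r) : Hgrp D := cls (dl i).

Definition zH (g : Hgrp D) : D := \prod_(i < r) z i ^+ coord dbar g i.

Definition fH (g g' : Hgrp D) : D := zH g * zH g' / zH (g + g').

(* t_i is the quotient of m_i + n_i by q_i; the remainder is beta(m + n)_i. *)
Definition tH (g g' : Hgrp D) (i : 'I_r) : nat :=
  ((coord dbar g i + coord dbar g' i) %/ qord dbar i)%N.

Definition hH (g g' : Hgrp D) : F := \prod_(i < r) x i ^+ tH g g' i.

Definition dH (g g' : Hgrp D) : D := fH g g' / (hH g g')%:A.

End FactorSetData.

(* Main.v *)
Require Import Defs.
From HB Require Import structures.
From mathcomp Require Import all_boot all_order all_algebra all_fingroup.
From mathcomp Require Import generic_quotient ring_quotient.
From mathcomp Require Import cyclic boolp classical_sets.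
From mathcomp Require Import zify.

Set Implicit Arguments.
Unset Strict Implicit.
Unset Printing Implicit Defensive.

Import GRing.Theory.
Local Open Scope ring_scope.

(** Write [m_i(g)] for the coordinates of [g] in the chosen basis, [q_i] for the
    orders of the basis elements and [t_i(g, g')] for the carries, so that
    [m_i(g) + m_i(g') = m_i(g + g') + q_i t_i(g, g')] ([coord_carry]).  The
    carries are thus the defect of additivity of [m_i] divided by [q_i], hence
    form a symmetric additive 2-cocycle ([carry_cocycle]); raising the units
    [x_i] to these powers gives the symmetric multiplicative cocycle [h].

    Conjugation by the homogeneous elements [z_g] together with
    [f(g, g') = z_g z_g' z_(g + g')^-1] satisfies the identities of a factor
    set, by cancellation.  Since [h] is a central cocycle, dividing [f] by it
    preserves them ([twist_conj], [twist_cocycle]).  The division is what brings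
    the values into [D_0]: the degree of [f(g, g')] is the sum of the
    [(m_i(g) + m_i(g') - m_i(g + g')) delta_i], that is, of the
    [t_i(g, g') q_i delta_i], which is the degree of [h(g, g')].  Finally [z_g]
    has degree in the class [g], so that conjugation by it restricts to
    [theta g] on the center of [D_0]. *)

Section Carries.
Variables (H : finZmodType) (r : nat) (e : 'I_r -> H).
Hypothesis eB : is_basis e.

Let carry (g g' : H) (i : 'I_r) :=
  ((Defs.coord e g i + Defs.coord e g' i) %/ qord e i)%N.

Lemma coordD g g' (i : 'I_r) :
  Defs.coord e (g + g') i =
  ((Defs.coord e g i + Defs.coord e g' i) %% qord e i)%N.
Proof.
have [mg gE] := coordP eB g; have [mg' g'E] := coordP eB g'.
pose n j := ((Defs.coord e g j + Defs.coord e g' j) %% qord e j)%N.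
have nI : box e n by move=> j; rewrite ltn_mod order_gt0.
have nE : comb e n = g + g'.
  rewrite -{1}gE -{1}g'E /comb -big_split /=; apply: eq_bigr => j _.
  by rewrite -mulrnDr; apply: (expg_mod_order (e j)).
by rewrite -nE (coord_comb eB nI).
Qed.

Lemma coord_carry g g' (i : 'I_r) : (Defs.coord e g i + Defs.coord e g' i =
  Defs.coord e (g + g')%R i + qord e i * carry g g' i)%N.
Proof. by rewrite coordD [RHS]addnC [(qord e i * _)%N]mulnC; apply: divn_eq. Qed.

(** Both sides, multiplied by the order of [e i], measure the defect of
    additivity of the [i]-th coordinate on a sum of three terms. *)
Lemma carry_cocycle s t u (i : 'I_r) :
  (carry s t i + carry (s + t)%R u i = carry t u i + carry s (t + u)%R i)%N.
Proof.
have carries (a b c ab bc abc m n p k : nat) :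
    (a + b = ab + m)%N -> (ab + c = abc + n)%N ->
    (b + c = bc + p)%N -> (a + bc = abc + k)%N -> (m + n = p + k)%N by lia.
have q0 : (0 < qord e i)%N by apply: order_gt0.
apply/eqP; rewrite -(eqn_pmul2l q0) !mulnDr; apply/eqP.
apply: carries (coord_carry s t i) (coord_carry (s + t) u i)
  (coord_carry t u i) _.
by rewrite -addrA coord_carry.
Qed.

End Carries.

Section Twist.
Variables (G : zmodType) (R : comUnitRingType) (A : unitAlgType R).
Variables (z : G -> A) (h : G -> G -> R).
Hypothesis z_unit : forall s, z s \is a GRing.unit.
Hypothesis h_unit : forall s t, h s t \is a GRing.unit.

Let d s t : A := z s * z t / z (s + t) / (h s t)%:A.

Lemma alg_unit (c : R) : c \is a GRing.unit -> c%:A \is a @GRing.unit A.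
Proof. exact: (rmorph_unit (in_alg A)). Qed.

Lemma twist_unit s t : d s t \is a GRing.unit.
Proof. by rewrite !unitrMl ?unitrV ?alg_unit ?z_unit. Qed.

(** The elements [z s] multiply like the basis of a crossed product whose
    cocycle is [d] times the central cocycle [h]; the conjugation and cocycle
    identities below reduce to this one. *)
Lemma twist_mul s t : d s t * z (s + t) = (h s t)^-1 *: (z s * z t).
Proof.
rewrite /d -(rmorphV (in_alg A)) ?h_unit //= mulr_algr -scalerAl.
by rewrite mulrVK ?z_unit.
Qed.

Lemma twist_conj s t a : z s * (z t * a / z t) / z s =
  d s t * (z (s + t) * a / z (s + t)) / d s t.
Proof.
rewrite [d s t * _]mulrA [d s t * _]mulrA -[RHS]mulrA.
rewrite -invrM ?twist_unit ?z_unit // twist_mul.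
rewrite invrZ ?unitrV ?unitrMl ?h_unit ?z_unit // invrK.
rewrite -scalerAl -scalerAl -scalerAr scalerA mulVr ?h_unit // scale1r.
by rewrite invrM ?z_unit // !mulrA.
Qed.

Hypothesis h_cocycle : forall s t u,
  h s t * h (s + t) u = h t u * h s (t + u).

(** After multiplication by [z (s + t + u)] on the right, both sides are
    scalar multiples of [z s * z t * z u], and the scalars agree by the
    cocycle condition on [h]. *)
Lemma twist_cocycle s t u :
  d s t * d (s + t) u = z s * d t u / z s * d s (t + u).
Proof.
apply: (mulIr (z_unit (s + t + u))).
rewrite -[LHS]mulrA twist_mul -scalerAr [d s t * _]mulrA twist_mul.
rewrite -scalerAl scalerA -addrA -[RHS]mulrA twist_mul -scalerAr.
rewrite [_ / z s * _]mulrA mulrVK ?z_unit //.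
rewrite -[z s * d t u * _]mulrA twist_mul -scalerAr scalerA mulrA.
by rewrite -!invrM ?h_unit // h_cocycle.
Qed.

End Twist.

Lemma hcomp_prodX (Gam : zmodType) (R : unitRingType) (G : grading Gam R)
    (r : nat) (a : 'I_r -> R) (d : 'I_r -> Gam) (m : 'I_r -> nat) :
    (forall i, a i \in G (d i)) ->
  \prod_(i < r) a i ^+ m i \in G (\sum_(i < r) d i *+ m i).
Proof.
move=> aG; elim/big_ind2: _ => [|b g c g' Gb Gc|i _].
- exact: hcomp1.
- exact: hcompM.
- elim: (m i) => [|n IHn]; first by rewrite mulr0n expr0 hcomp1.
  by rewrite mulrS exprS hcompM.
Qed.

Lemma unitr_prodX (R : unitRingType) (r : nat) (a : 'I_r -> R)
    (m : 'I_r -> nat) :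
    (forall i, a i \is a GRing.unit) ->
  \prod_(i < r) a i ^+ m i \is a GRing.unit.
Proof.
move=> aU; elim/big_ind: _ => [|b c Ub Uc|i _]; first exact: unitr1.
  by rewrite unitrMl.
exact: unitrX.
Qed.

Lemma hom_conj_ring_aut (Gam : zmodType) (F : gradedField Gam)
    (D : gradedCentralDivAlg F) (u : D) (w : D0 D -> D0 D) (g : Gam) :
    u \in gd_grading D g -> u \is a GRing.unit ->
    (forall a, d0val (w a) = u * d0val a / u) ->
  ring_aut w.
Proof.
move=> Gu Uu wE.
have GV := hcompV Uu Gu; have UV : u^-1 \is a GRing.unit by rewrite unitrV.
split.
- exists (fun a => MkD0 (conj_homog0 GV UV (d0P a))) => a;
    apply: val_inj; rewrite /= ?wE /= invrK.
    by rewrite !mulrA mulVr // mul1r mulrVK.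
  by rewrite !mulrA mulrV // mul1r mulrK.
- by move=> a b; apply: val_inj; rewrite /= !wE mulrBr mulrBl.
- split=> [|a b]; apply: val_inj; rewrite /= !wE.
    by rewrite mulr1 divrr.
  by rewrite !mulrA mulrVK.
Qed.

Theorem lemma1p7 (Gam : zmodType) (Gam_tf : torsion_free Gam)
    (F : gradedField Gam) (D : gradedCentralDivAlg F)
    (r : nat) (dl : 'I_r -> GammaD D) (dl_basis : is_basis (dbar dl))
    (x : 'I_r -> F) (x_unit : forall i, x i \is a GRing.unit)
    (x_gr : forall i,
       x i \in gf_grading F (gdeg (dl i) *+ qord (dbar dl) i))
    (z : 'I_r -> D) (z_unit : forall i, z i \is a GRing.unit)
    (z_gr : forall i, z i \in gd_grading D (gdeg (dl i))) :
  (exists (w : Hgrp D -> D0 D -> D0 D) (d : Hgrp D -> Hgrp D -> D0 D),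
     [/\ forall g a, d0val (w g a) = zH dl z g * d0val a / zH dl z g,
         forall g g', d0val (d g g') = dH dl x z g g'
       & factor_set (G := (Hgrp D : finZmodType)) (theta (D := D)) w d]) /\
  sym_cocycle (G := (Hgrp D : finZmodType)) (hH dl x).
Proof.
have hU s t : hH dl x s t \is a GRing.unit by apply: unitr_prodX.
have hC (s t u : Hgrp D) :
    hH dl x s t * hH dl x (s + t) u = hH dl x t u * hH dl x s (t + u).
  rewrite /hH -!big_split /=; apply: eq_bigr => i _.
  by rewrite -!exprD /tH (carry_cocycle dl_basis).
split; last first.
  split=> // s t; apply: eq_bigr => i _.
  by rewrite /tH addnC.
have zU g : zH dl z g \is a GRing.unit by apply: unitr_prodX.
pose E (g : Hgrp D) : GammaD D := \sum_(i < r) dl i *+ Defs.coord (dbar dl) g i.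
have EE g : gdeg (E g) = \sum_(i < r) gdeg (dl i) *+ Defs.coord (dbar dl) g i.
  apply: etrans (raddf_sum (\val : GammaD D -> Gam) _ _ _) _.
  apply: eq_bigr => i _.
  exact: (raddfMn (\val : GammaD D -> Gam)).
have zG g : zH dl z g \in gd_grading D (gdeg (E g)).
  by rewrite EE; apply: hcomp_prodX.
have clsE g : cls (E g) = g.
  have [_ {2}<-] := coordP dl_basis g.
  rewrite /cls raddf_sum; apply: eq_bigr => i _.
  exact: raddfMn.
pose w g a := MkD0 (conj_homog0 (zG g) (zU g) (d0P a)).
have dP g g' : dH dl x z g g' \in D0pred (D := D).
  (* The degree of [f g g'] is also that of [h g g'], by the carry equation. *)
  have hG : (hH dl x g g')%:A \in gd_grading D
      (gdeg (E g) + gdeg (E g') - gdeg (E (g + g'))).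
    rewrite gd_gr !EE -big_split /= -sumrB.
    rewrite (eq_bigr (fun i =>
      (gdeg (dl i) *+ qord (dbar dl) i) *+ tH dl g g' i)); last first.
      move=> i _; rewrite -mulrnDr (coord_carry dl_basis) mulrnDr addrC addKr.
      by rewrite mulrnA.
    exact: hcomp_prodX.
  rewrite /D0pred unfold_in /=.
  rewrite -[X in gd_grading D X](addrN
    (gdeg (E g) + gdeg (E g') - gdeg (E (g + g')))).
  apply: hcompM; last exact: hcompV (alg_unit _ (hU _ _)) hG.
  by apply: hcompM; [apply: hcompM | apply: hcompV].
pose d g g' := MkD0 (dP g g').
have dU g g' : d0val (d g g') \is a GRing.unit by apply: twist_unit.
have dU0 g g' : d g g' \is a GRing.unit.
  by apply: D0_unit; apply: contraTneq (dU g g') => ->; rewrite unitr0.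
have dV g g' : d0val (d g g')^-1 = (d0val (d g g'))^-1.
  exact: (rmorphV (\val : D0 D -> D)).
exists w, d; split=> //; split.
- by move=> s; apply: hom_conj_ring_aut (zG s) (zU s) _.
- exact: dU0.
- move=> s a; apply: val_inj => /=; rewrite !mulr1.
  by have := thetaE a (zG s) (zU s); rewrite clsE /= => ->.
- move=> s t a; apply: val_inj.
  transitivity (d0val (d s t) * d0val (w (s + t) a) * d0val (d s t)^-1) => //.
  by rewrite dV; apply: twist_conj.
- move=> s t u; apply: val_inj.
  exact: twist_cocycle.
Qed.
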